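(* Let $K$ be a field of characteristic $0$, let $n \geq 4$, let $L_n$ be the free Lie algebra over $K$ freely generated by $x_1,\ldots,x_n$, let $R_n = L_n/(\gamma_3(L_n') + (\gamma_3(L_n))')$, and let $y_i$ be the image of $x_i$ in $R_n$. For $\kappa\geq 1$ let $\omega_\kappa$ be the automorphism of $R_n$ with $\omega_\kappa(y_1) = y_1 + [y_1,y_2,{}_{(\kappa-1)}y_1,[y_3,y_4]]$ and $\omega_\kappa(y_j)=y_j$ for $j=2,\ldots,n$. Then the automorphisms $\omega_1$, $\omega_2$ and $\omega_3$ of $R_n$ are non-tame.
   Context: For a Lie algebra $L$, $\gamma_c(L)$ is the $c$-th term of the lower central series and $L'=\gamma_2(L)$. Commutators are left-normed, and $[a,{}_{m}b]$ denotes the left-normed commutator of $a$ followed by $m$ copies of $b$ (equal to $a$ if $m=0$); thus $[y_1,y_2,{}_{(\kappa-1)}y_1,[y_3,y_4]]=[[y_1,y_2,y_1,\ldots,y_1],[y_3,y_4]]$ with $\kappa-1$ copies of $y_1$ after $y_2$. An automorphism of $R_n$ is tame if it lies in the image of the group homomorphism $\mathrm{Aut}(L_n)\to\mathrm{Aut}(R_n)$ induced by the natural epimorphism $L_n\to R_n$; otherwise it is non-tame. *)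

(* Defs.v *)
From HB Require Import structures.
From mathcomp Require Import all_boot all_order all_algebra.
From mathcomp Require Import generic_quotient ring_quotient.
From mathcomp Require Import boolp classical_sets.

Set Implicit Arguments.
Unset Strict Implicit.
Unset Printing Implicit Defensive.

Import GRing.Theory.
Local Open Scope ring_scope.
Local Open Scope classical_set_scope.
Local Open Scope quotient_scope.

HB.mixin Record Lmodule_isLie (K : fieldType) L of GRing.Lmodule K L := {
  bracket : L -> L -> L;
  bracket_linearl : forall v : L, linear (bracket^~ v);
  bracket_linearr : forall u : L, linear (bracket u);
  bracketvv : forall u : L, bracket u u = 0;
  jacobi : forall u v w : L,
    bracket u (bracket v w) + bracket v (bracket w u)
      + bracket w (bracket u v) = 0 }.

#[short(type="lieAlgType")]
HB.structure Definition LieAlgebra (K : fieldType) :=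
  { L of GRing.Lmodule K L & Lmodule_isLie K L }.

Notation "[lie u , v ]" := (bracket u v)
  (at level 0, u, v at level 99, format "[lie  u ,  v ]") : ring_scope.

Section LieTheory.
Variables (K : fieldType) (L : lieAlgType K).
Implicit Types (u v w d : L) (A B I J : set L).

Lemma bracketDl u v w : [lie u + v, w] = [lie u, w] + [lie v, w].
Proof. by have := bracket_linearl w 1 u v; rewrite !scale1r. Qed.
Lemma bracketBl u v w : [lie u - v, w] = [lie u, w] - [lie v, w].
Proof.
by have := bracket_linearl w (-1) v u; rewrite !scaleN1r ![- _ + _]addrC.
Qed.
Lemma bracket0l w : [lie 0, w] = 0.
Proof. by rewrite -[X in [lie X, _]](subrr 0) bracketBl subrr. Qed.
Lemma bracketNl u w : [lie - u, w] = - [lie u, w].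
Proof. by rewrite -[- u]add0r bracketBl bracket0l add0r. Qed.
Lemma bracketDr u v w : [lie w, u + v] = [lie w, u] + [lie w, v].
Proof. by have := bracket_linearr w 1 u v; rewrite !scale1r. Qed.
Lemma bracketBr u v w : [lie w, u - v] = [lie w, u] - [lie w, v].
Proof.
by have := bracket_linearr w (-1) v u; rewrite !scaleN1r ![- _ + _]addrC.
Qed.

Lemma bracketC u v : [lie u, v] = - [lie v, u].
Proof.
have := bracketvv (u + v); rewrite bracketDl !bracketDr !bracketvv addr0 add0r.
by move=> /eqP; rewrite addr_eq0 => /eqP.
Qed.

Lemma bracket_der u v w : [lie [lie u, v], w] = [lie [lie u, w], v] + [lie u, [lie v, w]].
Proof.
have := jacobi u v w.
rewrite (bracketC v [lie w, u]) (bracketC w [lie u, v]) (bracketC w u) bracketNl opprK.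
by move=> /eqP; rewrite subr_eq0 => /eqP <-; rewrite addrC.
Qed.

Inductive lie_span A : set L :=
| LieSpan0 : lie_span A 0
| LieSpanZD (a : K) u v : A u -> lie_span A v -> lie_span A (a *: u + v).

Definition lie_prod A B : set L :=
  lie_span [set w | exists u v, [/\ A u, B v & w = [lie u, v]]].

(* [lcs A c] is gamma_c(A), numbered from gamma_1(A) = A; only c >= 1 is
   meaningful. *)
Definition lcs A (c : nat) : set L := iter c.-1 (fun B => lie_prod B A) A.

Definition lie_derived A : set L := lcs A 2.

Definition lie_add A B : set L :=
  [set w | exists u v, [/\ A u, B v & w = u + v]].

Record is_lie_ideal I : Prop := IsLieIdeal {
  lie_ideal0 : I 0;
  lie_idealZD : forall (a : K) u v, I u -> I v -> I (a *: u + v);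
  lie_idealM : forall u v, I u -> I [lie u, v] }.

Lemma lie_idealD I u v : is_lie_ideal I -> I u -> I v -> I (u + v).
Proof. by move=> idI Iu Iv; rewrite -[u]scale1r; apply: lie_idealZD. Qed.

Lemma lie_idealZ I a u : is_lie_ideal I -> I u -> I (a *: u).
Proof.
by move=> idI Iu; rewrite -[_ *: _]addr0; apply: lie_idealZD => //; apply: lie_ideal0.
Qed.

Lemma lie_idealN I u : is_lie_ideal I -> I u -> I (- u).
Proof. by move=> idI Iu; rewrite -scaleN1r; apply: lie_idealZ. Qed.

Lemma lie_idealB I u v : is_lie_ideal I -> I u -> I v -> I (u - v).
Proof. by move=> idI Iu Iv; apply: lie_idealD => //; apply: lie_idealN. Qed.

Lemma lie_idealMr I u v : is_lie_ideal I -> I v -> I [lie u, v].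
Proof. by move=> idI Iv; rewrite bracketC; apply: lie_idealN => //; apply: lie_idealM. Qed.

Lemma mem_lie_span A u : A u -> lie_span A u.
Proof.
move=> Au; rewrite -[u]scale1r -[_ *: _]addr0.
by apply: LieSpanZD => //; apply: LieSpan0.
Qed.

Lemma mem_lie_prod A B u v : A u -> B v -> lie_prod A B [lie u, v].
Proof. by move=> Au Bv; apply: mem_lie_span; exists u, v. Qed.

Lemma lie_spanZD A a u v : lie_span A u -> lie_span A v -> lie_span A (a *: u + v).
Proof.
elim=> [|b w z Aw _ IH] Av; first by rewrite scaler0 add0r.
by rewrite scalerDr scalerA -addrA; apply: LieSpanZD => //; apply: IH.
Qed.

Lemma lie_prod_ideal A B :
  is_lie_ideal A -> is_lie_ideal B -> is_lie_ideal (lie_prod A B).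
Proof.
move=> idA idB; split; first exact: LieSpan0; first exact: lie_spanZD.
move=> u v; elim=> [|a w z [s [t [As Bt ->]]] _ IH].
  by rewrite bracket0l; apply: LieSpan0.
rewrite bracket_linearl; apply: lie_spanZD => //.
rewrite bracket_der -[X in X + _]scale1r; apply: lie_spanZD.
  by apply: mem_lie_prod => //; apply: lie_idealM.
by apply: mem_lie_prod => //; apply: lie_idealM.
Qed.

Lemma lcs_ideal A c : is_lie_ideal A -> is_lie_ideal (lcs A c).
Proof.
move=> idA; rewrite /lcs; elim: c.-1 => //= k IH.
exact: lie_prod_ideal.
Qed.

Lemma setT_ideal : is_lie_ideal setT.
Proof. by []. Qed.

Lemma lie_add_ideal A B :
  is_lie_ideal A -> is_lie_ideal B -> is_lie_ideal (lie_add A B).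
Proof.
move=> idA idB; split.
- by exists 0, 0; rewrite addr0; split=> //; apply: lie_ideal0.
- move=> a _ _ [u [v [Au Bv ->]]] [s [t [As Bt ->]]].
  exists (a *: u + s), (a *: v + t); split; [exact: lie_idealZD..|].
  by rewrite scalerDr addrACA.
- move=> _ w [u [v [Au Bv ->]]].
  exists [lie u, w], [lie v, w]; split; [exact: lie_idealM..|].
  by rewrite bracketDl.
Qed.

End LieTheory.

Arguments LieSpan0 {K L A}.

Record lieIdeal (K : fieldType) (L : lieAlgType K) := LieIdeal {
  lie_ideal_carrier :> L -> Prop;
  lie_idealP : is_lie_ideal lie_ideal_carrier }.

Definition lie_ideal_mem (K : fieldType) (L : lieAlgType K) (I : lieIdeal L) :
  {pred L} := fun u => `[< I u >].

Section LieQuotient.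
Variables (K : fieldType) (L : lieAlgType K) (I : lieIdeal L).

Lemma lie_ideal_mem_closed : submod_closed (lie_ideal_mem I).
Proof.
have idI := lie_idealP I; split; first by apply/asboolP; apply: lie_ideal0.
move=> a u v /asboolP Iu /asboolP Iv.
by apply/asboolP; apply: lie_idealZD.
Qed.

HB.instance Definition _ :=
  GRing.isSubmodClosed.Build K L (lie_ideal_mem I) lie_ideal_mem_closed.

Definition lie_quot := Quotient.quot (lie_ideal_mem I).

HB.instance Definition _ := GRing.Zmodule.on lie_quot.
HB.instance Definition _ := EqQuotient.on lie_quot.

Definition lie_proj (u : L) : lie_quot := \pi_lie_quot u.

Lemma lie_projP u v : lie_proj u = lie_proj v <-> I (u - v).
Proof.
rewrite /lie_proj; split.
  by move/eqP; rewrite -Quotient.idealrBE => /asboolP.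
by move=> Iuv; apply/eqP; rewrite -Quotient.idealrBE; apply/asboolP.
Qed.

Lemma lie_proj_surj q : exists u, q = lie_proj u.
Proof. by exists (repr q); rewrite /lie_proj reprK. Qed.

Lemma lie_projD u v : lie_proj (u + v) = lie_proj u + lie_proj v.
Proof. exact: (@Quotient.pi_add L (lie_ideal_mem I) u v). Qed.

Lemma repr_lie_proj u : I (repr (lie_proj u) - u).
Proof. by apply/lie_projP; rewrite /lie_proj reprK. Qed.

Definition lie_quot_scale (a : K) (q : lie_quot) := lie_proj (a *: repr q).
Definition lie_quot_bracket (p q : lie_quot) := lie_proj [lie repr p, repr q].

Lemma lie_quot_scaleE a u : lie_quot_scale a (lie_proj u) = lie_proj (a *: u).
Proof.
apply/lie_projP; rewrite -scalerBr.
by apply: lie_idealZ; [apply: lie_idealP|apply: repr_lie_proj].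
Qed.

Lemma lie_quot_bracketE u v :
  lie_quot_bracket (lie_proj u) (lie_proj v) = lie_proj [lie u, v].
Proof.
apply/lie_projP.
set u' := repr _; set v' := repr _.
have -> : [lie u', v'] - [lie u, v] = [lie u' - u, v'] + [lie u, v' - v].
  by rewrite bracketBl bracketBr addrA subrK.
have idI := lie_idealP I.
by apply: lie_idealD => //; [apply: lie_idealM|apply: lie_idealMr] => //;
   apply: repr_lie_proj.
Qed.

Lemma lie_quot_scaleA a b q :
  lie_quot_scale a (lie_quot_scale b q) = lie_quot_scale (a * b) q.
Proof.
by have [u ->] := lie_proj_surj q; rewrite !lie_quot_scaleE scalerA.
Qed.

Lemma lie_quot_scale1 : left_id 1 lie_quot_scale.
Proof. by move=> q; have [u ->] := lie_proj_surj q; rewrite lie_quot_scaleE scale1r. Qed.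

Lemma lie_quot_scaleDr : right_distributive lie_quot_scale +%R.
Proof.
move=> a p q; have [u ->] := lie_proj_surj p; have [v ->] := lie_proj_surj q.
by rewrite -lie_projD !lie_quot_scaleE scalerDr lie_projD.
Qed.

Lemma lie_quot_scaleDl q : {morph lie_quot_scale^~ q : a b / a + b}.
Proof.
move=> a b; have [u ->] := lie_proj_surj q.
by rewrite !lie_quot_scaleE scalerDl lie_projD.
Qed.

HB.instance Definition _ := GRing.Zmodule_isLmodule.Build K lie_quot
  lie_quot_scaleA lie_quot_scale1 lie_quot_scaleDr lie_quot_scaleDl.

Lemma lie_projZ a u : lie_proj (a *: u) = a *: lie_proj u.
Proof. by rewrite -lie_quot_scaleE. Qed.

Lemma lie_proj_linear : linear lie_proj.
Proof. by move=> a u v; rewrite lie_projD lie_projZ. Qed.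

Lemma lie_quot_bracket_linearl q : linear (lie_quot_bracket^~ q).
Proof.
move=> a p p'; have [u ->] := lie_proj_surj p; have [v ->] := lie_proj_surj p'.
have [w ->] := lie_proj_surj q.
by rewrite -lie_proj_linear !lie_quot_bracketE bracket_linearl lie_proj_linear.
Qed.

Lemma lie_quot_bracket_linearr q : linear (lie_quot_bracket q).
Proof.
move=> a p p'; have [u ->] := lie_proj_surj p; have [v ->] := lie_proj_surj p'.
have [w ->] := lie_proj_surj q.
by rewrite -lie_proj_linear !lie_quot_bracketE bracket_linearr lie_proj_linear.
Qed.

Lemma lie_quot_bracketvv q : lie_quot_bracket q q = 0.
Proof.
have [u ->] := lie_proj_surj q; rewrite lie_quot_bracketE bracketvv.
by apply: (addrI (lie_proj 0)); rewrite -lie_projD !addr0.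
Qed.

Lemma lie_quot_jacobi p q r :
  lie_quot_bracket p (lie_quot_bracket q r)
    + lie_quot_bracket q (lie_quot_bracket r p)
    + lie_quot_bracket r (lie_quot_bracket p q) = 0.
Proof.
have [u ->] := lie_proj_surj p; have [v ->] := lie_proj_surj q.
have [w ->] := lie_proj_surj r.
rewrite !lie_quot_bracketE -!lie_projD jacobi.
by apply: (addrI (lie_proj 0)); rewrite -lie_projD !addr0.
Qed.

HB.instance Definition _ := Lmodule_isLie.Build K lie_quot
  lie_quot_bracket_linearl lie_quot_bracket_linearr
  lie_quot_bracketvv lie_quot_jacobi.

Lemma lie_projM u v : lie_proj [lie u, v] = [lie lie_proj u, lie_proj v].
Proof. by rewrite -lie_quot_bracketE. Qed.

End LieQuotient.

Definition lie_hom (K : fieldType) (L M : lieAlgType K) (f : L -> M) : Prop :=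
  linear f /\ {morph f : u v / [lie u, v]}.

Definition lie_aut (K : fieldType) (L : lieAlgType K) (f : L -> L) : Prop :=
  lie_hom f /\ bijective f.

Definition freely_generated (K : fieldType) (n : nat) (L : lieAlgType K)
    (x : 'I_n -> L) : Prop :=
  forall (M : lieAlgType K) (f : 'I_n -> M),
  exists h : L -> M,
    [/\ lie_hom h, forall i, h (x i) = f i
      & forall h' : L -> M, lie_hom h' -> (forall i, h' (x i) = f i) -> h' =1 h].

Lemma R_ideal_subproof (K : fieldType) (L : lieAlgType K) :
  is_lie_ideal (lie_add (lcs (lie_derived [set: L]) 3)
                        (lie_derived (lcs [set: L] 3))).
Proof. by apply: lie_add_ideal; do 2!apply: lcs_ideal; apply: setT_ideal. Qed.

Definition R_ideal (K : fieldType) (L : lieAlgType K) : lieIdeal L :=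
  LieIdeal (R_ideal_subproof L).

(* [f] lies in the image of the map Aut(L) -> Aut(L/I) that sends [phi] to the
   automorphism it induces. *)
Definition tame (K : fieldType) (L : lieAlgType K) (I : lieIdeal L)
    (f : lie_quot I -> lie_quot I) : Prop :=
  exists phi : L -> L,
    lie_aut phi /\ forall u : L, f (lie_proj I u) = lie_proj I (phi u).

Definition lnorm (K : fieldType) (L : lieAlgType K) (a : L) (m : nat) (b : L) : L :=
  iter m (fun u => [lie u, b]) a.

Definition omega_word (K : fieldType) (L : lieAlgType K) (kappa : nat)
    (y1 y2 y3 y4 : L) : L :=
  [lie lnorm [lie y1, y2] kappa.-1 y1, [lie y3, y4]].

(* The generators are numbered from 0 by 'I_n, so y_(k+1) is [y (gen4 hn k)],
   for k < 4. *)
Definition gen4 (n : nat) (hn : (4 <= n)%N) (k : nat) : 'I_n :=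
  widen_ord hn (inord k).

Definition is_omega (K : fieldType) (n : nat) (hn : (4 <= n)%N)
    (R : lieAlgType K) (y : 'I_n -> R) (kappa : nat) (f : R -> R) : Prop :=
  let y1 := y (gen4 hn 0) in let y2 := y (gen4 hn 1) in
  let y3 := y (gen4 hn 2) in let y4 := y (gen4 hn 3) in
  f y1 = y1 + omega_word kappa y1 y2 y3 y4 /\
  forall j : 'I_n, j != gen4 hn 0 -> f (y j) = y j.

Section OmegaExists.
Variables (K : fieldType) (n : nat) (hn : (4 <= n)%N).
Variables (L : lieAlgType K) (x : 'I_n -> L) (freeL : freely_generated x).
Variable kappa : nat.

Local Notation I := (R_ideal L).
Local Notation proj := (lie_proj I).
Local Notation D := (lie_derived [set: L]).

Lemma lie_hom_lnorm (M N : lieAlgType K) (h : M -> N) a m b :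
  lie_hom h -> h (lnorm a m b) = lnorm (h a) m (h b).
Proof. by case=> _ hM; elim: m => //= m IH; rewrite hM IH. Qed.

Lemma lie_hom_omega_word (M N : lieAlgType K) (h : M -> N) y1 y2 y3 y4 :
  lie_hom h ->
  h (omega_word kappa y1 y2 y3 y4) = omega_word kappa (h y1) (h y2) (h y3) (h y4).
Proof. by move=> hh; rewrite hh.2 lie_hom_lnorm // !hh.2. Qed.

Lemma lie_hom0 (M N : lieAlgType K) (h : M -> N) : lie_hom h -> h 0 = 0.
Proof.
by case=> /(_ (-1) 0 0); rewrite scaler0 addr0 scaleN1r addNr.
Qed.

Lemma lie_homB (M N : lieAlgType K) (h : M -> N) u v :
  lie_hom h -> h (u - v) = h u - h v.
Proof. by case=> /(_ (-1) v u); rewrite !scaleN1r ![- _ + _]addrC. Qed.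

Lemma lie_prod_hom (h : L -> L) (A A' B B' : set L) : lie_hom h ->
  (forall u, A u -> A' (h u)) -> (forall u, B u -> B' (h u)) ->
  forall u, lie_prod A B u -> lie_prod A' B' (h u).
Proof.
move=> hh hA hB u; elim=> [|a w z [s [t [As Bt ->]]] _ IH].
  by rewrite lie_hom0 //; apply: LieSpan0.
rewrite hh.1 hh.2; apply: lie_spanZD => //.
by apply: mem_lie_prod; [apply: hA|apply: hB].
Qed.

Lemma lcs_hom (h : L -> L) (A : set L) c : lie_hom h ->
  (forall u, A u -> A (h u)) -> forall u, lcs A c u -> lcs A c (h u).
Proof.
move=> hh hA; rewrite /lcs; elim: c.-1 => //= k IH u.
exact: lie_prod_hom.
Qed.

Lemma R_ideal_hom (h : L -> L) u : lie_hom h -> I u -> I (h u).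
Proof.
move=> hh [a [b [Ia Ib ->]]]; exists (h a), (h b); split.
- by move: Ia; do 2!apply: lcs_hom => //.
- by move: Ib; do 2!apply: lcs_hom => //.
- by have := hh.1 1 a b; rewrite !scale1r.
Qed.

Let lift (h : L -> L) (q : lie_quot I) : lie_quot I := proj (h (repr q)).

Lemma lift_proj h u : lie_hom h -> lift h (proj u) = proj (h u).
Proof.
move=> hh; apply/lie_projP; rewrite -lie_homB //.
by apply: R_ideal_hom => //; apply: repr_lie_proj.
Qed.

Lemma lift_hom h : lie_hom h -> lie_hom (lift h).
Proof.
move=> hh; split.
  move=> a p q; have [u ->] := lie_proj_surj p; have [v ->] := lie_proj_surj q.
  by rewrite -lie_proj_linear !lift_proj // hh.1 lie_proj_linear.
move=> p q; have [u ->] := lie_proj_surj p; have [v ->] := lie_proj_surj q.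
by rewrite -lie_projM !lift_proj // hh.2 lie_projM.
Qed.

Let x1 := x (gen4 hn 0).
Let w : L := omega_word kappa x1 (x (gen4 hn 1)) (x (gen4 hn 2)) (x (gen4 hn 3)).

Lemma lie_derived_mem u v : D [lie u, v].
Proof. exact: mem_lie_prod. Qed.

Let idD c : is_lie_ideal (lcs D c).
Proof. by do 2!apply: lcs_ideal; apply: setT_ideal. Qed.

Lemma lnorm_mem a m b : D a -> D (lnorm a m b).
Proof.
by move=> Da; elim: m => //= m IH; apply: (lie_idealM (lcs_ideal 2 (setT_ideal L))).
Qed.

Lemma lnorm_congr a a' m b b' : lcs D 2 (a' - a) -> lcs D 2 (b' - b) ->
  lcs D 2 (lnorm a' m b' - lnorm a m b).
Proof.
move=> Da Db; elim: m => //= m IH.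
set s := lnorm a' m b'; set t := lnorm a m b.
have -> : [lie s, b'] - [lie t, b] = [lie s - t, b'] + [lie t, b' - b].
  by rewrite bracketBl bracketBr addrA subrK.
by apply: (lie_idealD (idD 2)); [apply: (lie_idealM (idD 2))
                               |apply: (lie_idealMr _ (idD 2))].
Qed.

Lemma w_mem : lcs D 2 w.
Proof.
by apply: mem_lie_prod; [apply: lnorm_mem; apply: lie_derived_mem|apply: lie_derived_mem].
Qed.

Lemma gen4_neq k : (0 < k < 4)%N -> gen4 hn k != gen4 hn 0.
Proof. by case/andP=> k0 k4; rewrite -val_eqE /= !inordK // -lt0n. Qed.

Lemma shift_exists (eps : K) : exists h : L -> L, [/\ lie_hom h,
  h x1 = x1 + eps *: w, forall j, j != gen4 hn 0 -> h (x j) = x j & I (h w - w)].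
Proof.
have [h [hh hx _]] := freeL (fun j => if j == gen4 hn 0 then x1 + eps *: w else x j).
have h1 : h x1 = x1 + eps *: w by rewrite hx eqxx.
have hj j : j != gen4 hn 0 -> h (x j) = x j by move=> /negPf j0; rewrite hx j0.
exists h; split=> //; rewrite lie_hom_omega_word // h1 !hj ?gen4_neq //.
rewrite -bracketBl.
have Dw : lcs D 2 (x1 + eps *: w - x1).
  by rewrite addrAC subrr add0r; apply: (lie_idealZ _ (idD 2)); apply: w_mem.
exists [lie lnorm [lie x1 + eps *: w, x (gen4 hn 1)] kappa.-1 (x1 + eps *: w) -
        lnorm [lie x1, x (gen4 hn 1)] kappa.-1 x1,
        [lie x (gen4 hn 2), x (gen4 hn 3)]], 0.
split; last by rewrite addr0.
  apply: mem_lie_prod; last exact: lie_derived_mem.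
  by apply: lnorm_congr => //; rewrite -bracketBl; apply: (lie_idealM (idD 2)).
exact: LieSpan0.
Qed.

Lemma lift_inv (h k : L -> L) (a b : K) : lie_hom h -> lie_hom k ->
  a + b = 0 -> h x1 = x1 + a *: w -> k x1 = x1 + b *: w ->
  (forall j, j != gen4 hn 0 -> h (x j) = x j) ->
  (forall j, j != gen4 hn 0 -> k (x j) = x j) ->
  I (h w - w) -> cancel (lift k) (lift h).
Proof.
move=> hh kh ab hx kx hj kj hw q; have [u ->] := lie_proj_surj q.
rewrite !lift_proj //.
have [g [gh gx gU]] := freeL (fun j => proj (x j)).
have -> : proj u = g u.
  apply: gU => //; split; [exact: lie_proj_linear|exact: lie_projM].
apply: (gU (fun u => proj (h (k u)))).
  by split=> [c s t|s t] /=; rewrite ?kh.1 ?hh.1 ?kh.2 ?hh.2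
    ?lie_proj_linear ?lie_projM.
move=> j; have [->|j0] := eqVneq j (gen4 hn 0); last by rewrite kj // hj.
rewrite -/x1 kx; apply/lie_projP.
have hD : h (x1 + b *: w) = h x1 + b *: h w.
  by rewrite addrC hh.1 addrC.
rewrite hD hx addrAC [x1 + _]addrC addrK -[a](addr0) -(subrr b) addrA ab.
rewrite add0r scaleNr addrC -scalerBr.
by apply: (lie_idealZ _ (lie_idealP I)).
Qed.

Lemma omega_exists : exists omega : lie_quot I -> lie_quot I,
  lie_aut omega /\ is_omega hn (fun i => proj (x i)) kappa omega.
Proof.
have [h [hh hx hj hw]] := shift_exists 1.
have [k [kh kx kj kw]] := shift_exists (-1).
exists (lift h); split.
  split; first exact: lift_hom.
  exists (lift k); first exact: (lift_inv kh hh (addNr 1)).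
  exact: (lift_inv hh kh (subrr 1)).
split=> [|j j0]; rewrite lift_proj //; last by rewrite hj.
rewrite -/x1 hx scale1r lie_projD.
rewrite (@lie_hom_omega_word L _ (lie_proj I)) //.
by split; [exact: lie_proj_linear|exact: lie_projM].
Qed.

End OmegaExists.

(* Main.v *)
Require Import Defs.
From HB Require Import structures.
From mathcomp Require Import all_boot all_order all_algebra all_fingroup.
From mathcomp Require Import ring.
From mathcomp Require Import boolp classical_sets.

Set Implicit Arguments.
Unset Strict Implicit.
Unset Printing Implicit Defensive.

Import GRing.Theory.
Local Open Scope ring_scope.

(** The obstruction is a trace of Fox derivatives.  Let [rho] be a
    representation of [L] by matrices over the polynomial ring K[t], and let
    [d_i] be the derivations of [L] into matrices with
    [d_i [u, v] = d_i u * rho v - d_i v * rho u] and [d_i x_j = delta_ij].  For an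
    automorphism [phi] of [L] the chain rule makes the Jacobian matrix
    [J = (d_i (phi x_j))] invertible over K[t] ([fox_jacobian_unit]), so [det J]
    is a nonzero constant.  If moreover [J = 1 + t^2 M], then
    [det J = 1 + t^2 tr M + O(t^4)], so the coefficient of [t^3] in [tr (J - 1)]
    is zero ([mxtrace_coef3_unit]).

    Take the 2 x 2 representation x_1 -> 1, x_2 -> t E_12, x_3 -> t E_21,
    x_4 -> t E_11, the other generators going to 0.  All values of [rho] and of
    the [d_i] are scalar modulo t ([scalar_modt_fox]), and a commutator with a
    matrix that is scalar modulo t gains a factor t.  Hence [rho] is O(t^2) on
    L' and O(t^3) on gamma_3(L), which yields that
    - [d_i] is O(t^2) on [L', L'] and O(t^4) on gamma_3(L');
    - [tr (d_i u)] is O(t^4) for [u] in gamma_3(L)': up to O(t^4), the trace of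
      [d_i p * rho q] is a scalar times the trace of [rho q], and [rho q] is a sum
      of commutators.
    The word [w] that omega adds to y_1 and the ideal that defines R_n both lie in
    [L', L'], so [J] has the form [1 + t^2 M] for any [phi] inducing omega, and
    this ideal adds nothing to the coefficient of [t^3]
    ([dvdp_mxtrace_der_R_ideal]).  But [w] does: as
    [rho x_1 = 1], each further bracket with x_1 leaves [d_1] unchanged, so that
    [d_1 w = t E_12 * t^2 [E_21, E_11] = t^3 E_11], whose trace is [t^3]
    ([mxtrace_der_omega_word]).  An automorphism of [L] inducing omega would
    satisfy [phi x_1 = x_1 + w] and [phi x_j = x_j] for [j > 1] up to that ideal,
    and the coefficient of [t^3] in [tr (J - 1)] would be both 1 and 0. *)

(** * Subalgebras of a free Lie algebra *)

Record lieSubalg (K : fieldType) (L : lieAlgType K) := LieSubalg {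
  subalg_carrier :> {pred L};
  subalg_submod : submod_closed subalg_carrier;
  subalg_bracket : forall u v, u \in subalg_carrier -> v \in subalg_carrier ->
    [lie u, v] \in subalg_carrier }.

Section Subalgebra.
Variables (K : fieldType) (L : lieAlgType K) (S : lieSubalg L).

HB.instance Definition _ :=
  GRing.isSubmodClosed.Build K L (subalg_carrier S) (subalg_submod S).

Record subalg_of := SubalgOf {
  subalg_val :> L;
  subalg_valP : subalg_val \in subalg_carrier S }.

HB.instance Definition _ := [isSub for subalg_val].
HB.instance Definition _ := [Choice of subalg_of by <:].
HB.instance Definition _ := [SubChoice_isSubLmodule of subalg_of by <:].

Definition subalg_lie (u v : subalg_of) : subalg_of :=
  SubalgOf (subalg_bracket (subalg_valP u) (subalg_valP v)).

Lemma subalg_val_linear : linear subalg_val.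
Proof. exact: (linearP (val : subalg_of -> L)). Qed.

Lemma subalg_lie_linearl v : linear (subalg_lie^~ v).
Proof. by move=> a u w; apply: val_inj; rewrite linearP /= bracket_linearl. Qed.

Lemma subalg_lie_linearr u : linear (subalg_lie u).
Proof. by move=> a v w; apply: val_inj; rewrite linearP /= bracket_linearr. Qed.

Lemma subalg_lievv u : subalg_lie u u = 0.
Proof. by apply: val_inj; rewrite raddf0 /= bracketvv. Qed.

Lemma subalg_jacobi u v w :
  subalg_lie u (subalg_lie v w) + subalg_lie v (subalg_lie w u)
    + subalg_lie w (subalg_lie u v) = 0.
Proof. by apply: val_inj; rewrite !raddfD raddf0 /= jacobi. Qed.

HB.instance Definition _ := Lmodule_isLie.Build K subalg_of
  subalg_lie_linearl subalg_lie_linearr subalg_lievv subalg_jacobi.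

(** Induction on a free Lie algebra: the universal property retracts [L] onto any
    subalgebra containing the free generators, and by uniqueness the retraction
    followed by the inclusion is the identity. *)
Lemma free_subalgT n (x : 'I_n -> L) : freely_generated x ->
  (forall i, x i \in subalg_carrier S) -> forall u, u \in subalg_carrier S.
Proof.
move=> freeL Sx u.
have [h [hh hx _]] := freeL subalg_of (fun i => SubalgOf (Sx i)).
have [g [_ _ gU]] := freeL L x.
have gid : id =1 g by apply: gU.
have gh : (fun v => subalg_val (h v)) =1 g.
  apply: gU => [|i]; last by rewrite hx.
  by split=> [a v w|v w]; rewrite ?hh.1 ?hh.2 ?subalg_val_linear.
by rewrite [u]gid -gh; apply: subalg_valP.
Qed.

End Subalgebra.

(** * Fox derivatives *)

(** The semidirect product of gl_m(R) with [n] copies of the right module of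
    m x m matrices.  A Lie homomorphism [h] from [L] to it is a representation
    [fun u => (h u).1] together with [n] derivations [fun u => (h u).2 i] along it,
    so the universal property of a free Lie algebra produces Fox derivatives
    without its enveloping algebra. *)
Definition fox_alg (K : fieldType) (R : comAlgType K) (m n : nat) : Type :=
  'M[R]_m * {ffun 'I_n -> 'M[R]_m}.

Section FoxAlgebra.
Variables (K : fieldType) (R : comAlgType K) (m n : nat).
Local Notation F := (fox_alg R m n).
Local Notation M := 'M[R]_m.

HB.instance Definition _ := GRing.Zmodule.on F.

Definition fox_scale (a : K) (p : F) : F :=
  a%:A *: (p : M * {ffun 'I_n -> M})%type.

Lemma fox_scaleA a b p : fox_scale a (fox_scale b p) = fox_scale (a * b) p.
Proof. by rewrite /fox_scale scalerA -scalerAl mul1r scalerA. Qed.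
Lemma fox_scale1 : left_id 1 fox_scale.
Proof. by move=> p; rewrite /fox_scale !scale1r. Qed.
Lemma fox_scaleDr : right_distributive fox_scale +%R.
Proof. by move=> a p q; rewrite /fox_scale -scalerDr. Qed.
Lemma fox_scaleDl p : {morph fox_scale^~ p : a b / a + b}.
Proof. by move=> a b; rewrite /fox_scale 2!scalerDl. Qed.

HB.instance Definition _ := GRing.Zmodule_isLmodule.Build K F
  fox_scaleA fox_scale1 fox_scaleDr fox_scaleDl.

Definition fox_lie (p q : F) : F :=
  (p.1 *m q.1 - q.1 *m p.1,
   [ffun i => p.2 i *m q.1 - q.2 i *m p.1]).

Lemma fox_lieE p q :
  ((fox_lie p q).1 = p.1 *m q.1 - q.1 *m p.1)
  * (forall i, (fox_lie p q).2 i = p.2 i *m q.1 - q.2 i *m p.1).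
Proof. by split=> // i; rewrite ffunE. Qed.

Lemma fox_linP a (p q : F) :
  ((a *: p + q).1 = a%:A *: p.1 + q.1)
  * (forall i, (a *: p + q).2 i = a%:A *: p.2 i + q.2 i).
Proof. by split=> // i; rewrite !ffunE. Qed.

Lemma fox_addE (p q : F) :
  ((p + q).1 = p.1 + q.1) * (forall i, (p + q).2 i = p.2 i + q.2 i).
Proof. by split=> // i; rewrite ffunE. Qed.

Lemma foxP (p q : F) : p.1 = q.1 -> (forall i, p.2 i = q.2 i) -> p = q.
Proof. by case: p q => [A f] [B g] /= -> fg; congr pair; apply/ffunP. Qed.

Let addmxE (A B : M) i j : (A + B) i j = A i j + B i j. Proof. by rewrite mxE. Qed.
Let oppmxE (A : M) i j : (- A) i j = - A i j. Proof. by rewrite mxE. Qed.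
Let scalemxE a (A : M) i j : (a *: A) i j = a * A i j. Proof. by rewrite mxE. Qed.
Let mxring :=
  (mulmxDl, mulmxDr, mulNmx, mulmxN, =^~ scalemxAl, =^~ scalemxAr, mulmxA).

Lemma fox_lie_linearl q : linear (fox_lie^~ q).
Proof.
move=> a p p'; apply: foxP => [|i]; rewrite !(fox_lieE, fox_linP) !mxring;
  by apply/matrixP => k l; rewrite !(addmxE, oppmxE, scalemxE); ring.
Qed.

Lemma fox_lie_linearr p : linear (fox_lie p).
Proof.
move=> a q q'; apply: foxP => [|i]; rewrite !(fox_lieE, fox_linP) !mxring;
  by apply/matrixP => k l; rewrite !(addmxE, oppmxE, scalemxE); ring.
Qed.

Lemma fox_lievv p : fox_lie p p = 0.
Proof. by apply: foxP => [|i]; rewrite fox_lieE subrr // ffunE. Qed.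

Lemma fox_jacobi p q r :
  fox_lie p (fox_lie q r) + fox_lie q (fox_lie r p) + fox_lie r (fox_lie p q) = 0.
Proof.
apply: foxP => [|i]; rewrite !(fox_addE, fox_lieE) !mxring;
  by apply/matrixP => k l; rewrite ?ffunE [RHS]mxE !(addmxE, oppmxE); ring.
Qed.

HB.instance Definition _ := Lmodule_isLie.Build K F
  fox_lie_linearl fox_lie_linearr fox_lievv fox_jacobi.

End FoxAlgebra.

(** * The Jacobian matrix of an automorphism *)

Section Jacobian.
Variables (K : fieldType) (R : comAlgType K) (m n : nat).
Variables (L : lieAlgType K) (x : 'I_n -> L).
Local Notation F := (fox_alg R m n).

Section Components.
Variables (h : L -> F) (hh : lie_hom h).

Lemma fox_repZD a u v : (h (a *: u + v)).1 = a%:A *: (h u).1 + (h v).1.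
Proof. by rewrite hh.1 fox_linP. Qed.

Lemma fox_derZD a u v i :
  (h (a *: u + v)).2 i = a%:A *: (h u).2 i + (h v).2 i.
Proof. by rewrite hh.1 fox_linP. Qed.

Lemma fox_repM u v :
  (h [lie u, v]).1 = (h u).1 *m (h v).1 - (h v).1 *m (h u).1.
Proof. by rewrite hh.2 fox_lieE. Qed.

Lemma fox_derM u v i :
  (h [lie u, v]).2 i = (h u).2 i *m (h v).1 - (h v).2 i *m (h u).1.
Proof. by rewrite hh.2 fox_lieE. Qed.

End Components.

(** Chain rule.  Write [k] for the Fox derivatives along the twisted
    representation [(h (phi _)).1].  Then [h \o phi] and the image of [k] under
    the Jacobian matrix of [phi] are homomorphisms with the same values on the
    generators, hence equal; evaluated at the preimages of the generators under
    [phi], this equality inverts the Jacobian matrix. *)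
Lemma fox_jacobian_unit (freeL : freely_generated x) (phi : L -> L) (h : L -> F) :
    lie_aut phi -> lie_hom h ->
    (forall i j, (h (x j)).2 i = (i == j)%:R%:M) ->
  exists J', \mxblock_(i < n, j < n) (h (phi (x j))).2 i *m J' = 1%:M.
Proof.
move=> [phih [psi phiK psiK]] hh hx.
have [k [kh kx _]] := freeL F
  (fun j => ((h (phi (x j))).1, [ffun i => (i == j)%:R%:M])).
(* Left multiplication by the Jacobian matrix commutes with the right action of
   gl_m, hence is a Lie endomorphism of the Fox algebra. *)
pose act (p : F) : F :=
  (p.1, [ffun i => \sum_j (h (phi (x j))).2 i *m p.2 j]).
have act_lin : linear act.
  move=> a p q; apply: foxP => [|i]; rewrite !(fox_linP, ffunE) //=.
  rewrite ?ffunE scaler_sumr -big_split; apply: eq_bigr => j _ /=.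
  by rewrite fox_linP mulmxDr -scalemxAr.
have act_lie p q : act [lie p, q] = [lie act p, act q].
  apply: foxP => [|i]; rewrite !fox_lieE //= !ffunE !mulmx_suml -sumrB.
  by apply: eq_bigr => j _; rewrite fox_lieE mulmxBr !mulmxA.
have [g [_ _ gU]] := freeL F (h \o phi \o x).
have chain : h \o phi =1 act \o k.
  move=> u; transitivity (g u); [|symmetry]; apply: gU => //.
  - by split=> [a v w|v w] /=; rewrite ?phih.1 ?hh.1 ?phih.2 ?hh.2.
  - by split=> [a v w|v w] /=; rewrite ?kh.1 ?kh.2 ?act_lin ?act_lie.
  move=> j; apply: foxP => [|i] /=; rewrite kx //= ffunE.
  rewrite (bigD1 j) //= ffunE eqxx mulmx1 big1 ?addr0 // => l /negPf lj.
  by rewrite ffunE lj mulr0n raddf0 mulmx0.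
exists (\mxblock_(i < n, j < n) (k (psi (x j))).2 i).
rewrite mul_mxblock -mxdiagZ /mxdiag; apply: eq_mxblock => i j.
have := congr1 (fun p : F => p.2 i) (chain (psi (x j))).
rewrite /= psiK hx ffunE => <-.
by case: eqP => _; rewrite ?conform_mx_id ?raddf0.
Qed.

End Jacobian.

(** * Determinants of matrices close to the identity *)

Section DetExpansion.
Variable R : comNzRingType.

Lemma prod_1pM (I : Type) (r : seq I) (a : I -> R) s :
  exists q, \prod_(i <- r) (1 + s * a i) = 1 + s * \sum_(i <- r) a i + s ^+ 2 * q.
Proof.
elim: r => [|i r [q IH]]; first by exists 0; rewrite !big_nil !mulr0 !addr0.
exists (a i * \sum_(j <- r) a j + (1 + s * a i) * q).
by rewrite !big_cons IH; ring.
Qed.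

(** In the Leibniz formula, a permutation other than the identity moves at least
    two points, so its term has at least two off-diagonal factors, each a multiple
    of [s]. *)
Lemma det_1pZ n (A : 'M[R]_n) s :
  exists q, \det (1%:M + s *: A) = 1 + s * \tr A + s ^+ 2 * q.
Proof.
have entryE i j : (1%:M + s *: A) i j = (i == j)%:R + s * A i j by rewrite !mxE.
rewrite /determinant (bigD1 1%g) //= odd_perm1 expr0 mul1r.
have [q0 ->] : exists q, \prod_i (1%:M + s *: A) i ((1 : 'S_n)%g i)
    = 1 + s * \tr A + s ^+ 2 * q.
  have [q Hq] := prod_1pM (index_enum 'I_n) (fun i => A i i) s.
  exists q; rewrite -Hq; apply: eq_bigr => i _.
  by rewrite perm1 entryE eqxx.
suff [q1 ->] : exists q, \sum_(p : 'S_n | p != 1%g)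
    (-1) ^+ p * \prod_i (1%:M + s *: A) i (p i) = s ^+ 2 * q.
  by exists (q0 + q1); ring.
elim/big_ind: _ => [|a b [q ->] [q' ->]|p p1].
- by exists 0; rewrite mulr0.
- by exists (q + q'); rewrite mulrDr.
have [i pi] : exists i, p i != i.
  apply/existsP; apply: contraR p1; rewrite negb_exists => /forallP pE.
  by apply/eqP/permP => i; rewrite perm1; apply/eqP; rewrite -[_ == _]negbK.
have ppi : p (p i) != p i by rewrite (inj_eq perm_inj).
rewrite (bigD1 i) //= (bigD1 (p i)) //= !entryE [i == _]eq_sym (negPf pi).
rewrite [p i == _]eq_sym (negPf ppi) !add0r.
set sg := (-1) ^+ p; set t := \prod_(_ | _) _.
by exists (sg * A i (p i) * A (p i) (p (p i)) * t); ring.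
Qed.

End DetExpansion.

(** * Orders of vanishing at t = 0 *)

Section Order.
Variables (K : fieldType) (m : nat).
Implicit Types (A B : 'M[{poly K}]_m) (c d : nat).

(** Here and below t is the variable ['X]. *)
Definition tdvd_mx c A : Prop := exists B, A = 'X^c *: B.

Lemma tdvd_mx0 c : tdvd_mx c 0.
Proof. by exists 0; rewrite scaler0. Qed.

Lemma tdvd_mxD c A B : tdvd_mx c A -> tdvd_mx c B -> tdvd_mx c (A + B).
Proof. by move=> [A' ->] [B' ->]; exists (A' + B'); rewrite scalerDr. Qed.

Lemma tdvd_mxZ c a A : tdvd_mx c A -> tdvd_mx c (a *: A).
Proof. by move=> [A' ->]; exists (a *: A'); rewrite !scalerA mulrC. Qed.

Lemma tdvd_mxN c A : tdvd_mx c A -> tdvd_mx c (- A).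
Proof. by rewrite -scaleN1r; apply: tdvd_mxZ. Qed.

Lemma tdvd_mxM c d A B : tdvd_mx c A -> tdvd_mx d B -> tdvd_mx (c + d) (A *m B).
Proof.
move=> [A' ->] [B' ->]; exists (A' *m B').
by rewrite -scalemxAl -scalemxAr scalerA exprD.
Qed.

Lemma tdvd_mxW c d A : (c <= d)%N -> tdvd_mx d A -> tdvd_mx c A.
Proof.
move=> cd [A' ->]; exists ('X^(d - c) *: A').
by rewrite scalerA -exprD subnKC.
Qed.

Lemma dvdp_mxtrace c A : tdvd_mx c A -> 'X^c %| \tr A.
Proof. by move=> [B ->]; rewrite linearZ /= dvdp_mulIl. Qed.

(** The matrices that are scalar at [t = 0]: they commute with every matrix up to
    a factor t. *)
Definition scalar_modt A : Prop := exists a : {poly K}, tdvd_mx 1 (A - a%:M).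

Lemma scalar_modtP A :
  scalar_modt A <-> exists (a : {poly K}) B, A = a%:M + 'X *: B.
Proof.
split=> [[c [B AE]]|[c [B ->]]]; exists c, B.
  by rewrite -['X]expr1 -AE addrC subrK.
by rewrite expr1 addrAC subrr add0r.
Qed.

Lemma scalar_modt0 : scalar_modt 0.
Proof. by exists 0; rewrite raddf0 subr0; apply: tdvd_mx0. Qed.

Lemma scalar_modtZD a A B :
  scalar_modt A -> scalar_modt B -> scalar_modt (a *: A + B).
Proof.
move=> /scalar_modtP[c [A' ->]] /scalar_modtP[d [B' ->]]; apply/scalar_modtP.
exists (a * c + d), (a *: A' + B').
by by apply/matrixP => i j; rewrite !mxE; case: eqP => _; rewrite ?mulr1n ?mulr0n; ring.
Qed.

Lemma scalar_modtB A B : scalar_modt A -> scalar_modt B -> scalar_modt (A - B).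
Proof. by rewrite addrC -scaleN1r => hA hB; apply: scalar_modtZD. Qed.

Lemma scalar_modtM A B : scalar_modt A -> scalar_modt B -> scalar_modt (A *m B).
Proof.
move=> /scalar_modtP[c [A' ->]] /scalar_modtP[d [B' ->]]; apply/scalar_modtP.
exists (c * d), (c *: B' + (A' *m (d%:M + 'X *: B'))).
rewrite mulmxDl -scalemxAl mul_scalar_mx !scalerDr addrA scale_scalar_mx.
by rewrite !scalerA ['X * c]mulrC.
Qed.

Lemma tdvd_commutator c A B : tdvd_mx c A -> scalar_modt B ->
  tdvd_mx c.+1 (A *m B - B *m A).
Proof.
move=> Ac /scalar_modtP[d [B' ->]].
rewrite mulmxDl mulmxDr scalar_mxC opprD addrACA subrr add0r -addn1.
have B1 : tdvd_mx 1 ('X *: B') by exists B'; rewrite expr1.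
apply: tdvd_mxD; first exact: tdvd_mxM.
by apply: tdvd_mxN; rewrite addnC; apply: tdvd_mxM.
Qed.

Lemma tdvd2_commutator A B : scalar_modt A -> scalar_modt B ->
  tdvd_mx 2 (A *m B - B *m A).
Proof.
move=> /scalar_modtP[c [A' ->]] sB.
rewrite mulmxDl mulmxDr scalar_mxC opprD addrACA subrr add0r.
by apply: tdvd_commutator => //; exists A'; rewrite expr1.
Qed.

(** At [t = 0] the factor [B] is scalar and comes out of the trace. *)
Lemma dvdp_mxtrace_mul c A B :
  tdvd_mx c A -> \tr A = 0 -> scalar_modt B -> 'X^(c.+1) %| \tr (B *m A).
Proof.
move=> Ac trA /scalar_modtP[d [B' ->]].
rewrite mulmxDl mul_scalar_mx mxtraceD mxtraceZ trA mulr0 add0r.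
by apply: dvdp_mxtrace; apply: (@tdvd_mxM 1 c) => //; exists B'; rewrite expr1.
Qed.

Lemma tdvd_mxE c A : (forall i j, 'X^c %| A i j) -> tdvd_mx c A.
Proof.
move=> Ac; exists (map_mx (fun p => p %/ 'X^c) A).
by apply/matrixP => i j; rewrite !mxE mulrC divpK.
Qed.

Lemma dvdp_tdvd_mx c A i j : tdvd_mx c A -> 'X^c %| A i j.
Proof. by move=> [B ->]; rewrite mxE dvdp_mulIl. Qed.

(** A matrix invertible over K[t] has constant determinant, and in
    [1 + \tr B + O(t^4)] nothing else can cancel the term of degree 3. *)
Lemma mxtrace_coef3_unit (B C : 'M[{poly K}]_m) :
  tdvd_mx 2 B -> (1%:M + B) *m C = 1%:M -> (\tr B)`_3 = 0.
Proof.
move=> [M ->] /(congr1 determinant); rewrite det_mulmx det1 mxtraceZ.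
have [q ->] := det_1pZ M 'X^2.
rewrite -exprM; set p := 1 + _ + _ => detU.
have : p \is a GRing.unit by apply/unitrPr; exists (\det C).
rewrite poly_unitE => /andP[/eqP p1 _].
have := nth_default (0 : K) (leq_trans (eq_leq p1) (isT : (1 <= 3)%N)).
by rewrite /p !coefD [('X^_ * q)`_3]coefXnM coef1 /= add0r addr0.
Qed.

End Order.

Lemma lie_prod_ind (K : fieldType) (L : lieAlgType K) (A B P : L -> Prop) :
  P 0 -> (forall a u v, P u -> P v -> P (a *: u + v)) ->
  (forall u v, A u -> B v -> P [lie u, v]) -> forall u, lie_prod A B u -> P u.
Proof.
move=> P0 PZD PM u; elim=> // a _ v [s [t [As Bt ->]]] _ Pv.
by apply: PZD => //; apply: PM.
Qed.

(** * Fox derivatives along a representation that is scalar at t = 0 *)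

Section Estimates.
Variables (K : fieldType) (m n : nat) (L : lieAlgType K) (x : 'I_n -> L).
Variable freeL : freely_generated x.
Variable h : L -> fox_alg {poly K} m n.
Variable hh : lie_hom h.
Variable rho_x : forall j, scalar_modt (h (x j)).1.
Variable der_x : forall i j, scalar_modt ((h (x j)).2 i).

Local Notation rho u := (h u).1.
Local Notation der i u := ((h u).2 i).
Local Notation D := (lie_derived (@setT L)).
Local Notation G3 := (lcs (@setT L) 3).

Let foxZD := (fox_repZD hh, fox_derZD hh).

Lemma rho0 : rho 0 = 0. Proof. by rewrite lie_hom0. Qed.
Lemma der0 i : der i 0 = 0. Proof. by rewrite lie_hom0 //= ffunE. Qed.

(** Matrices that are scalar modulo t form an algebra, so the elements of [L] with
    this property form a subalgebra. *)
Lemma scalar_modt_fox u : scalar_modt (rho u) /\ forall i, scalar_modt (der i u).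
Proof.
pose P : {pred L} := fun u =>
  `[< scalar_modt (rho u) /\ forall i, scalar_modt (der i u) >].
have Psub : submod_closed P.
  split=> [|a v w /asboolP[v1 v2] /asboolP[w1 w2]]; apply/asboolP.
    by split=> [|i]; rewrite ?rho0 ?der0; apply: scalar_modt0.
  by split=> [|i]; rewrite foxZD; apply: scalar_modtZD.
have PM v w : v \in P -> w \in P -> [lie v, w] \in P.
  move=> /asboolP[v1 v2] /asboolP[w1 w2]; apply/asboolP.
  by split=> [|i]; rewrite (fox_repM hh, fox_derM hh);
     apply: scalar_modtB; apply: scalar_modtM.
apply/asboolP; apply: (@free_subalgT _ _ (LieSubalg Psub PM) _ _ freeL) => j.
by apply/asboolP.
Qed.

Lemma rho_scalar u : scalar_modt (rho u). Proof. by case: (scalar_modt_fox u). Qed.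
Lemma der_scalar i u : scalar_modt (der i u). Proof. by case: (scalar_modt_fox u). Qed.

Lemma tdvd_rho_prod c d A B : (forall u, A u -> tdvd_mx c (rho u)) ->
  (forall u, B u -> tdvd_mx d (rho u)) ->
  forall u, lie_prod A B u -> tdvd_mx (c + d) (rho u).
Proof.
move=> Ac Bd; apply: lie_prod_ind => [|a u v uc vc|u v Au Bv].
- by rewrite rho0; apply: tdvd_mx0.
- by rewrite foxZD; apply: tdvd_mxD => //; apply: tdvd_mxZ.
rewrite (fox_repM hh); apply: tdvd_mxD; first by apply: tdvd_mxM; auto.
by apply: tdvd_mxN; rewrite addnC; apply: tdvd_mxM; auto.
Qed.

(** In [der i [u, v]] the term [der i u * rho v] has order [e + d]; for the term
    [der i v * rho u] only the order [c] of [rho u] is used. *)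
Lemma tdvd_der_prod c d e A B :
  (forall u, A u -> tdvd_mx c (rho u)) -> (forall u, B u -> tdvd_mx d (rho u)) ->
  (forall u i, A u -> tdvd_mx e (der i u)) ->
  forall u, lie_prod A B u -> forall i, tdvd_mx (minn (e + d) c) (der i u).
Proof.
move=> Ac Bd Ae; apply: lie_prod_ind => [i|a u v uc vc i|u v Au Bv i].
- by rewrite der0; apply: tdvd_mx0.
- by rewrite foxZD; apply: tdvd_mxD => //; apply: tdvd_mxZ.
rewrite (fox_derM hh); apply: tdvd_mxD.
  by apply: tdvd_mxW (geq_minl _ _) _; apply: tdvd_mxM; auto.
apply/tdvd_mxN/(tdvd_mxW (geq_minr _ _)).
by rewrite -[c]add0n; apply: tdvd_mxM; auto; exists (der i v); rewrite expr0 scale1r.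
Qed.

Lemma tdvd_rho_derived u : D u -> tdvd_mx 2 (rho u).
Proof.
move: u; apply: lie_prod_ind => [|a u v u2 v2|u v _ _].
- by rewrite rho0; apply: tdvd_mx0.
- by rewrite foxZD; apply: tdvd_mxD => //; apply: tdvd_mxZ.
by rewrite (fox_repM hh); apply: tdvd2_commutator; apply: rho_scalar.
Qed.

Lemma tdvd_rho_gamma3 u : G3 u -> tdvd_mx 3 (rho u).
Proof.
move: u; apply: lie_prod_ind => [|a u v u2 v2|u v Du _].
- by rewrite rho0; apply: tdvd_mx0.
- by rewrite foxZD; apply: tdvd_mxD => //; apply: tdvd_mxZ.
rewrite (fox_repM hh); apply: tdvd_commutator; last exact: rho_scalar.
exact: tdvd_rho_derived.
Qed.

Lemma mxtrace_rho_prod A B u : lie_prod A B u -> \tr (rho u) = 0.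
Proof.
move: u; apply: lie_prod_ind => [|a u v u2 v2|u v _ _].
- by rewrite rho0 raddf0.
- by rewrite foxZD linearP /= u2 v2 mulr0 addr0.
by rewrite (fox_repM hh) raddfB /= mxtrace_mulC subrr.
Qed.

Lemma gamma3_derived u : G3 u -> D u.
Proof.
move: u; apply: lie_prod_ind => [|a u v|u v Du _]; first exact: LieSpan0.
  exact: lie_spanZD.
exact: (lie_idealM (lcs_ideal 2 (setT_ideal L))).
Qed.

Lemma tdvd_der_derived2 u i : lcs D 2 u -> tdvd_mx 2 (der i u).
Proof.
move=> u2; apply: (@tdvd_der_prod 2 2 0 D D) => //; try exact: tdvd_rho_derived.
by move=> v j _; exists (der j v); rewrite expr0 scale1r.
Qed.

Lemma tdvd_der_derived3 u i : lcs D 3 u -> tdvd_mx 4 (der i u).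
Proof.
move=> u3; apply: (@tdvd_der_prod 4 2 2 (lcs D 2) D) => //.
- by move=> v; apply: (@tdvd_rho_prod 2 2); apply: tdvd_rho_derived.
- exact: tdvd_rho_derived.
- by move=> v j; apply: tdvd_der_derived2.
Qed.

(** Here the derivatives themselves are only O(t^3): the fourth factor t comes from
    the trace, [rho] being traceless on gamma_3(L). *)
Lemma dvdp_mxtrace_der_derived_gamma3 u i :
  lie_derived G3 u -> 'X^4 %| \tr (der i u).
Proof.
move: u; apply: lie_prod_ind => [|a u v u4 v4|u v Gu Gv].
- by rewrite der0 raddf0 dvdp0.
- by rewrite foxZD linearP /= dvdp_add // dvdp_mull.
rewrite (fox_derM hh) raddfB /= dvdp_sub //; apply: (@dvdp_mxtrace_mul _ _ 3);
  by [apply: tdvd_rho_gamma3|apply: der_scalar|apply: mxtrace_rho_prod Gu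
     |apply: mxtrace_rho_prod Gv].
Qed.

Lemma R_ideal_derived2 u : R_ideal L u -> lcs D 2 u.
Proof.
have D2 : is_lie_ideal (lcs D 2) by do 2!apply: lcs_ideal; apply: setT_ideal.
case=> v [w [Dv Gw ->]]; apply: lie_idealD => //.
  move: Dv; apply: lie_prod_ind => [|a u' v'|u' v' Du _].
  - exact: LieSpan0.
  - exact: lie_spanZD.
  exact: (lie_idealM D2).
move: Gw; apply: lie_prod_ind => [|a u' v'|u' v' Gu Gv]; first exact: LieSpan0.
  exact: lie_spanZD.
by apply: mem_lie_prod; apply: gamma3_derived.
Qed.

Lemma dvdp_mxtrace_der_R_ideal u i : R_ideal L u -> 'X^4 %| \tr (der i u).
Proof.
case=> v [w [Dv Gw ->]]; rewrite -[v]scale1r foxZD linearP /=.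
apply: dvdp_add; last exact: dvdp_mxtrace_der_derived_gamma3.
by apply/dvdp_mull/dvdp_mxtrace/tdvd_der_derived3.
Qed.

End Estimates.

(** * The representation detecting omega *)

Section Detection.
Variable K : fieldType.

(** The generator moved by omega acts as the identity, the others vanish at
    [t = 0], and the matrix units are chosen so that the trace of
    [omega_rep 1 * [omega_rep 2, omega_rep 3]] is not zero. *)
Definition omega_rep (j : nat) : 'M[{poly K}]_2 :=
  nth 0 [:: 1%:M; 'X *: delta_mx 0 1; 'X *: delta_mx 1 0; 'X *: delta_mx 0 0] j.

Lemma omega_rep_scalar j : scalar_modt (omega_rep j).
Proof.
have Xs (B : 'M[{poly K}]_2) : scalar_modt ('X *: B).
  by apply/scalar_modtP; exists 0, B; rewrite raddf0 add0r.
case: j => [|[|[|[|j]]]]; try exact: Xs.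
  by exists 1; rewrite subrr; apply: tdvd_mx0.
by rewrite [omega_rep _](_ : _ = 0); [apply: scalar_modt0|case: j].
Qed.

Variables (n : nat) (hn : (4 <= n)%N) (L : lieAlgType K) (x : 'I_n -> L).
Variables (h : L -> fox_alg {poly K} 2 n) (hh : lie_hom h).
Variable rho_x : forall j : 'I_n, (h (x j)).1 = omega_rep j.
Variable der_x : forall i j, (h (x j)).2 i = (i == j)%:R%:M.
Local Notation g := (gen4 hn).

Lemma rho_gen4 k : (k < 4)%N -> (h (x (g k))).1 = omega_rep k.
Proof. by move=> k4; rewrite rho_x /= inordK. Qed.

Lemma der_gen4 k : (0 < k < 4)%N -> (h (x (g k))).2 (g 0) = 0.
Proof. by move=> k4; rewrite der_x eq_sym (negPf (gen4_neq hn k4)) raddf0. Qed.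

(** Since [x_1] acts as the identity, every bracket with it is killed by the
    representation, and bracketing further with it does not change [d_1]. *)
Lemma fox_lnorm m (u := lnorm [lie x (g 0), x (g 1)] m (x (g 0))) :
  (h u).1 = 0 /\ (h u).2 (g 0) = omega_rep 1.
Proof.
rewrite {}/u; elim: m => [|m [IH1 IH2]] /=.
  rewrite (fox_repM hh) (fox_derM hh) (@der_gen4 1) // der_x eqxx !rho_gen4 //=.
  by rewrite mul1mx mulmx1 mul0mx subr0 subrr.
rewrite (fox_repM hh) (fox_derM hh) IH1 IH2 !rho_gen4 //=.
by rewrite !mulmx0 !mulmx1 !subr0.
Qed.

Lemma mxtrace_der_omega_word kappa :
  \tr ((h (omega_word kappa (x (g 0)) (x (g 1)) (x (g 2)) (x (g 3)))).2 (g 0)) = 'X^3.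
Proof.
have [r0 d1] := fox_lnorm kappa.-1.
rewrite /omega_word (fox_derM hh) r0 d1 (fox_repM hh) mulmx0 subr0 !rho_gen4 //.
rewrite /omega_rep /= -!scalemxAl -!scalemxAr !mul_delta_mx_cond.
rewrite !mulr1n !mulr0n !scaler0 subr0 -!scalemxAr mul_delta_mx_cond mulr1n.
rewrite !scalerA mxtraceZ /mxtrace !big_ord_recl big_ord0 !mxE /= !addr0 mulr1.
by rewrite !exprS expr0 mulr1 mulrA.
Qed.

End Detection.

Theorem corollary4p1 (K : fieldType) (charK0 : [pchar K] =i pred0)
    (n : nat) (hn : (4 <= n)%N)
    (L : lieAlgType K) (x : 'I_n -> L) (freeL : freely_generated x)
    (kappa : nat) (hkappa : (1 <= kappa <= 3)%N)
    (omega : lie_quot (R_ideal L) -> lie_quot (R_ideal L))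
    (omega_aut : lie_aut omega)
    (omegaE : is_omega hn (fun i => lie_proj (R_ideal L) (x i)) kappa omega) :
  ~ tame omega.
Proof.
case=> phi [phi_aut phiE].
set g := gen4 hn; pose g0 := g 0.
pose w := omega_word kappa (x (g 0)) (x (g 1)) (x (g 2)) (x (g 3)).
have [h [hh hx _]] := freeL (fox_alg {poly K} 2 n)
  (fun j => (omega_rep K j, [ffun i => (i == j)%:R%:M])).
have rho_x (j : 'I_n) : (h (x j)).1 = omega_rep K j by rewrite hx.
have der_x i j : (h (x j)).2 i = (i == j)%:R%:M by rewrite hx ffunE.
have rho_s j : scalar_modt (h (x j)).1 by rewrite hx; apply: omega_rep_scalar.
have der_s i j : scalar_modt ((h (x j)).2 i).
  by rewrite der_x; exists (i == j)%:R; rewrite subrr; apply: tdvd_mx0.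
pose u j := phi (x j) - (x j + if j == g0 then w else 0).
have uI j : R_ideal L (u j).
  apply/lie_projP; rewrite -phiE /g0.
  have [->|j0] := eqVneq j (g 0); last by rewrite addr0 omegaE.2.
  rewrite omegaE.1 lie_projD; congr (_ + _); apply/esym/lie_hom_omega_word.
  by split; [apply: lie_proj_linear|apply: lie_projM].
have phi_x j : phi (x j) = x j + ((if j == g0 then w else 0) + u j).
  by rewrite /u addrA addrC subrK.
have w2 : lcs (lie_derived (@setT L)) 2 w by apply: w_mem.
(* [N] is the block decomposition of [J - 1]. *)
pose N i j := (h (phi (x j) - x j)).2 i.
have N2 i j : tdvd_mx 2 (N i j).
  rewrite /N phi_x addrAC subrr add0r; apply: tdvd_der_derived2 => //.
  apply: lie_idealD; first by do 2!apply: lcs_ideal; apply: setT_ideal.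
    by case: ifP => _ //; apply: LieSpan0.
  exact: R_ideal_derived2.
have trN : 'X^4 %| \sum_j \tr (N j j) - 'X^3.
  rewrite (bigD1 g0) //= /N phi_x eqxx.
  have addh v v' i : (h (v + v')).2 i = (h v).2 i + (h v').2 i.
    by rewrite -[v]scale1r (fox_derZD hh) !scale1r.
  rewrite [x _ + _]addrC addrK addh mxtraceD (mxtrace_der_omega_word hn hh rho_x der_x).
  rewrite -[X in X - _]addrA addrAC subrr add0r; apply: dvdp_add.
    exact: dvdp_mxtrace_der_R_ideal.
  elim/big_ind: _ => [|p q|j /negPf j0]; [exact: dvdp0|exact: dvdp_add|].
  rewrite phi_x j0 add0r addrAC subrr add0r.
  exact: dvdp_mxtrace_der_R_ideal.
have [J' JJ'] := fox_jacobian_unit freeL phi_aut hh der_x.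
have JE : \mxblock_(i < n, j < n) (h (phi (x j))).2 i
    = 1%:M + \mxblock_(i < n, j < n) N i j.
  rewrite -mxdiagZ -mxblockD; apply: eq_mxblock => i j.
  rewrite /N lie_homB //= !ffunE /= der_x.
  case: eqP => _; last by rewrite raddf0 subr0 add0r.
  by rewrite conform_mx_id mulr1n addrC subrK.
have B2 : tdvd_mx 2 (\mxblock_(i < n, j < n) N i j).
  by apply: tdvd_mxE => k l; rewrite mxE; apply: dvdp_tdvd_mx.
move: JJ'; rewrite JE => /(mxtrace_coef3_unit B2).
rewrite mxtrace_mxblock; case/dvdpP: trN => r /(canRL (subrK _)) ->.
by rewrite coefD coefMXn coefXn add0r => /eqP; rewrite oner_eq0.
Qed.
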